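(* Let $\pi$ be a (not necessarily unique) QSD of $(X_t)_{0\le t<\tau_\partial}$, $\lambda=\lambda(\pi)$, and assume the reverse anti-Dobrushin condition (RaD) holds with time $t_2>0$ and constant $C_2'<\infty$. Set $C_2:=\lambda^{t_2}C_2'$. Then $$P_{t_2}(x,\cdot)\le C_2\,\pi(\cdot)\quad\text{for every }x\in\chi .$$
   Context: $\chi$ is a metric space with Borel $\sigma$-algebra; $\partial\notin\chi$ is a cemetery point. $(X_t)_{0\le t<\tau_\partial}$ is a killed Markov process on $\chi$ in discrete or continuous time, absorption time $\tau_\partial=\inf\{t\ge0:X_t=\partial\}$, submarkovian semigroup $P_t(x,A)=\mathbb P_x(X_t\in A,\tau_\partial>t)$; $K1(x)=K(x,\chi)$ for a kernel $K$. A QSD is a probability measure $\pi$ with $\mathbb P_\pi(X_t\in\cdot\mid\tau_\partial>t)=\pi$ for all $t$; $\lambda(\pi):=\mathbb P_\pi(\tau_\partial>1)$. A submarkovian kernel $K$ is lower semicontinuous if $Kf$ is lower semicontinuous for every bounded continuous $f\ge0$. $\mathrm{spt}(\pi)$ denotes the support. Reverse anti-Dobrushin condition (RaD): there exist a time $t_2>0$ and a submarkovian kernel $R^{(2)}$ with $\pi(dx)P_{t_2}(x,dy)=\pi(dy)R^{(2)}(y,dx)$ as measures on $\chi\times\chi$, and $C_2'<\infty$ with $R^{(2)}(y,\cdot)/R^{(2)}1(y)\le C_2'\pi(\cdot)$ for $\pi$-a.e. $y$; moreover $\mathrm{spt}(\pi)=\chi$ and $P_{t_2}$ is lower semicontinuous.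 *)

(* Defs.v *)
From HB Require Import structures.
From mathcomp Require Import all_boot all_order all_algebra.
From mathcomp Require Import all_classical all_reals all_analysis.
From mathcomp Require Import measurable_realfun.
Set Implicit Arguments. Unset Strict Implicit. Unset Printing Implicit Defensive.
Import Order.TTheory GRing.Theory Num.Theory.
Import numFieldNormedType.Exports.
Local Open Scope classical_set_scope.
Local Open Scope ring_scope.

Notation borelT T := (g_sigma_algebraType (@open T)).

Section QSD.
Context {R : realType} {T : pseudoPMetricType R}.
Local Notation X := (borelT T).
Local Open Scope ereal_scope.

Definition is_time (disc : bool) (t : R) : Prop :=
  (0 <= t)%R /\ (disc -> t \is a Num.nat).

Definition submarkov_kernel (K : X -> {measure set X -> \bar R}) : Prop :=
  (forall A : set X, measurable A -> measurable_fun [set: X] (K ^~ A)) /\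
  (forall x, K x setT <= 1).

Definition submarkov_semigroup (disc : bool)
    (P : R -> X -> {measure set X -> \bar R}) : Prop :=
  (forall t, is_time disc t -> submarkov_kernel (P t)) /\
  (forall x (A : set X), measurable A -> P 0%R x A = \d_x A) /\
  (forall s t x (A : set X), is_time disc s -> is_time disc t -> measurable A ->
     P (s + t)%R x A = \int[P s x]_y P t y A).

(* (pi P_t)(A) = P_pi(X_t in A, tau > t) *)
Definition muP (P : R -> X -> {measure set X -> \bar R})
    (pi : probability X R) (t : R) (A : set X) : \bar R :=
  \int[pi]_x P t x A.

(* quasi-stationary distribution: P_pi(X_t in . | tau > t) = pi for all t *)
Definition is_QSD (disc : bool) (P : R -> X -> {measure set X -> \bar R})
    (pi : probability X R) : Prop :=
  forall t, is_time disc t ->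
    0 < muP P pi t setT /\
    forall A : set X, measurable A ->
      (fine (muP P pi t A) / fine (muP P pi t setT))%R = fine (pi A).

(* lambda(pi) = P_pi(tau > 1) *)
Definition lam (P : R -> X -> {measure set X -> \bar R}) (pi : probability X R) : R :=
  fine (muP P pi 1%R setT).

Definition spt (pi : probability X R) : set X :=
  [set x | forall U : set T, open U -> U x -> 0 < pi U].

Definition lsc_kernel (K : X -> {measure set X -> \bar R}) : Prop :=
  forall f : T -> R, continuous f -> (exists M : R, forall x, (`|f x| <= M)%R) ->
    (forall x, (0 <= f x)%R) ->
    lower_semicontinuous (fun x : T => \int[K x]_y (f y)%:E).

Definition RaD (disc : bool) (P : R -> X -> {measure set X -> \bar R})
    (pi : probability X R) (t2 : R) (R2 : X -> {measure set X -> \bar R})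
    (C2' : R) : Prop :=
  [/\ (0 < t2)%R, is_time disc t2 & submarkov_kernel R2] /\
   (* pi(dx) P_{t2}(x,dy) = pi(dy) R2(y,dx) as measures on X * X *)
   (forall E : set (X * X), measurable E ->
      \int[pi]_x P t2 x (xsection E x) = \int[pi]_y R2 y (ysection E y)) /\
   (* R2(y,.)/R2 1(y) <= C2' pi(.) for pi-a.e. y *)
   {ae pi, forall y, forall A : set X, measurable A ->
      R2 y A <= C2'%:E * R2 y setT * pi A} /\
   spt pi = setT /\
   lsc_kernel (P t2).

End QSD.

(* Main.v *)
Require Import Defs.
From HB Require Import structures.
From mathcomp Require Import all_boot all_order all_algebra.
From mathcomp Require Import all_classical all_reals all_analysis.
From mathcomp Require Import measurable_realfun.
From mathcomp Require Import giry lra.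
Import Order.TTheory GRing.Theory Num.Theory.
Import numFieldNormedType.Exports.
Local Open Scope classical_set_scope.
Local Open Scope ring_scope.

(** Quasi-stationarity gives pi P_t = lambda^t pi, because the survival function
    t |-> P_pi(tau > t) is multiplicative and takes values in (0, 1]. Hence the
    reversed kernel has mass R2 1(y) = lambda^t2 for pi-a.e. y, and the reverse
    anti-Dobrushin bound turns time reversal into
      int_B P_t2(x, A) pi(dx) <= C2 pi(A) pi(B)    for all Borel A, B.
    For A = U open, x |-> P_t2(x, U) is lower semicontinuous, so a point with
    P_t2(x, U) > C2 pi(U) would have an open neighbourhood B on which P_t2(., U)
    exceeds a constant larger than C2 pi(U); full support gives pi(B) > 0,
    contradicting the bound. Outer regularity of pi extends the inequality from
    open to Borel sets. *)

(** * Truncated distance to a set, separating a closed set from the points outside it *)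

Section truncated_distance.
Context {R : realType} {T : pseudoMetricType R}.
Implicit Types F : set T.

(* Truncation at 1 keeps the value finite when F is empty or infinitely far. *)
Definition trunc_dist F (x : T) : R := fine (mine 1%E (edist_inf F x)).

Lemma trunc_distE F x : (trunc_dist F x)%:E = mine 1%E (edist_inf F x).
Proof.
rewrite /trunc_dist fineK// ge0_fin_numE ?le_min ?lee01 ?edist_inf_ge0//.
by rewrite gt_min ltry.
Qed.

Lemma trunc_dist_ge0 F x : 0 <= trunc_dist F x.
Proof. by rewrite -lee_fin trunc_distE le_min lee01 edist_inf_ge0. Qed.

Lemma trunc_dist0 F x : F x -> trunc_dist F x = 0.
Proof.
by move=> Fx; rewrite /trunc_dist edist_inf0// min_r.
Qed.

Lemma trunc_dist_continuous F : continuous (trunc_dist F).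
Proof.
move=> x.
have : continuous (fun y => mine 1%E (edist_inf F y)).
  apply: (@min_fun_continuous _ _ _ (cst 1%E)); first exact: cst_continuous.
  exact: edist_inf_continuous.
move=> /(_ x); rewrite /continuous_at -trunc_distE => /fine_cvgP[_].
exact: cvg_trans.
Qed.

(** The value 0 rules out the truncated branch, so the untruncated infimum is 0 and every ball
    around [x] meets [F]; closedness then puts [x] in [F]. *)
Lemma trunc_dist_eq0 F x : closed F -> trunc_dist F x = 0 -> F x.
Proof.
move=> cF d0; have := trunc_distE F x; rewrite d0 => {}d0.
have {}d0 : edist_inf F x = 0%E.
  by move: d0; rewrite minElt; case: ifP => // _ [/esym/eqP]; rewrite oner_eq0.
apply: cF => B xB; have /nbhs_ballP[e /= e0 eB] := xB.
have [|_ [z Fz <-] ze] := @lb_ereal_inf_adherent R [set edist (x, a) | a in F] e e0.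
  by rewrite -/(edist_inf F x) d0.
exists z; split => //; apply: eB; apply: (@edist_lt_ball _ _ e (x, z)).
by move: ze; rewrite -/(edist_inf F x) d0 add0e.
Qed.

Lemma trunc_dist_gt0 F x : closed F -> ~ F x -> 0 < trunc_dist F x.
Proof.
move=> cF Fx; rewrite lt_neqAle trunc_dist_ge0 andbT eq_sym; apply/eqP => d0.
exact: Fx (trunc_dist_eq0 F x cF d0).
Qed.

End truncated_distance.

(** * Borel sets and approximation of closed sets from outside *)

Section borel.
Context {R : realType} {T : pseudoPMetricType R}.
Local Open Scope ereal_scope.

Lemma open_borel (U : set T) : open U -> measurable (U : set (borelT T)).
Proof. exact: sub_sigma_algebra. Qed.

Lemma closed_borel (F : set T) : closed F -> measurable (F : set (borelT T)).
Proof.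
move=> cF; rewrite -[F]setCK; apply: (@measurableC _ (borelT T)).
by apply: open_borel; rewrite openC.
Qed.

Lemma continuous_borel (f : T -> R) :
  continuous f -> measurable_fun [set: borelT T] f.
Proof.
move=> cf; apply: (measurability _ (RGenOpens.measurableE R)).
move=> /= _ [_ [a [b ->]] <-]; rewrite setTI.
by apply: open_borel; apply: open_comp => [x _|]; [exact: cf|exact: interval_open].
Qed.

(** A closed set is the decreasing intersection of its open neighbourhoods of radius 1/(n+1), and a
    finite measure is continuous from above. *)
Lemma closed_regular (mu : {finite_measure set (borelT T) -> \bar R}) (F : set T) (e : R) :
  closed F -> (0 < e)%R ->
  exists2 U : set T, open U /\ F `<=` U & mu (U `\` F) < e%:E.
Proof.
move=> cF e0.
pose V n := [set x : T | (trunc_dist F x < n.+1%:R^-1)%R].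
have oV n : open (V n).
  apply: (open_comp (D := [set r : R | (r < n.+1%:R^-1)%R])); last exact: open_lt.
  by move=> x _; exact: trunc_dist_continuous.
have VF0 : \bigcap_n (V n `\` F) = set0.
  apply/seteqP; split => // x Vx; have [_ /= Fx] := Vx 0%N I.
  have d0 := trunc_dist_gt0 F x cF Fx.
  have [n _ /(_ n (leqnn n))/=] := near_infty_natSinv_lt (PosNum d0).
  by have [/= /ltW + _] := Vx n I; rewrite leNgt => /negP.
have mVF n : measurable (V n `\` F : set (borelT T)).
  by apply: measurableD; [exact: open_borel|exact: closed_borel].
have : (mu \o (fun n => V n `\` F)) n @[n --> \oo] --> mu (\bigcap_n (V n `\` F)).
  apply: nonincreasing_cvg_mu => //.
  - by rewrite ltey_eq fin_num_measure.
  - by rewrite VF0.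
  - move=> n m nm; apply/subsetPset; apply: setSD => x /= /lt_le_trans; apply.
    by rewrite lef_pV2 ?posrE// ler_nat.
rewrite VF0 measure0 => /fine_cvgP[_ /cvgrPdist_lt /(_ _ e0)[n _ /(_ n (leqnn n))]].
rewrite /= sub0r normrN ger0_norm ?fine_ge0// => Vn.
exists (V n); first by split => // x /trunc_dist0; rewrite /V /= => ->; rewrite invr_gt0.
by rewrite -[ltLHS]fineK ?lte_fin// fin_num_measure.
Qed.

End borel.

(** * Regularity of finite Borel measures *)

Section regularity.
Context {R : realType} {T : pseudoPMetricType R}.
Variable mu : {finite_measure set (borelT T) -> \bar R}.
Local Open Scope ereal_scope.

(** Two-sided approximation is used because it is symmetric under complement, which outer
    approximation alone is not; this lets the regular sets form a sigma-algebra. *)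
Let regular (A : set (borelT T)) := forall e : R, (0 < e)%R ->
  exists F U : set T, [/\ closed F, open U, F `<=` A, A `<=` U &
    mu (U `\` F) < e%:E].

Let regularC A : regular A -> regular (~` A).
Proof.
move=> rA e /rA[F [U [cF oU FA AU mUF]]].
exists (~` U), (~` F); split; [by rewrite closedC|by rewrite openC|exact: subsetC|exact: subsetC|].
by rewrite setDE setCK setIC -setDE.
Qed.

Let regular_bigcup (A : (set (borelT T))^nat) :
  (forall n, regular (A n)) -> regular (\bigcup_n A n).
Proof.
move=> rA e e0.
(* The errors sum to at most [e / 2]. The other half pays for replacing the union of the closed
   sets, which may fail to be closed, by a finite subunion. *)
have e2 n : (0 < e / 2 / (2 ^ n.+1)%:R)%R by rewrite !divr_gt0// ltr0n expn_gt0.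
have /choice[FU FUP] n : exists FU : set T * set T,
    [/\ closed FU.1, open FU.2, FU.1 `<=` A n, A n `<=` FU.2 &
     mu (FU.2 `\` FU.1) < (e / 2 / (2 ^ n.+1)%:R)%:E].
  by have [F [U ?]] := rA n _ (e2 n); exists (F, U).
pose F n := (FU n).1; pose U n := (FU n).2.
have mF n : measurable (F n : set (borelT T)).
  by apply: closed_borel; case: (FUP n).
have mU n : measurable (U n : set (borelT T)).
  by apply: open_borel; case: (FUP n).
(* The [G n] decrease to the difference of the two full unions, so some [G N] already has measure
   below [e]. *)
pose G n := \bigcup_k U k `\` \big[setU/set0]_(i < n) F i.
have mG n : measurable (G n : set (borelT T)).
  by apply: measurableD; [exact: bigcup_measurable|exact: bigsetU_measurable].
have capG : \bigcap_n G n = \bigcup_k U k `\` \bigcup_k F k.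
  apply/seteqP; split => [x Gx|x [Ux Fx] n _].
    split; first by have [] := Gx 0%N I.
    move=> [k _ Fkx]; have [_] := Gx k.+1 I; apply.
    by rewrite -bigcup_mkord; exists k => /=.
  by split => //; rewrite -bigcup_mkord => -[k _ Fkx]; apply: Fx; exists k.
have mcapG : measurable (\bigcap_n G n : set (borelT T)).
  exact: bigcapT_measurable.
have : (mu \o G) n @[n --> \oo] --> mu (\bigcap_n G n).
  apply: nonincreasing_cvg_mu => //.
    by rewrite ltey_eq fin_num_measure.
  by move=> n m nm; apply/subsetPset; apply: setDS; exact: (@subset_bigsetU _ F _ _ nm).
have capGe : mu (\bigcap_n G n) < e%:E.
  apply: (@le_lt_trans _ _ (e / 2)%:E); last by rewrite lte_fin gtr_pMr// invf_lt1// ltr1n.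
  apply: (@le_trans _ _ (\sum_(0 <= n <oo) mu (U n `\` F n))).
    apply: measure_sigma_subadditive => //; first by move=> n; exact: measurableD.
    rewrite capG => x [[k _ Ukx] Fx]; exists k => //; split => // Fkx.
    by apply: Fx; exists k.
  apply: le_trans (epsilon_trick0 xpredT _); last by rewrite divr_ge0// ltW.
  by apply: lee_nneseries => // n _; case: (FUP n) => _ _ _ _ /ltW.
move=> /(_ [set y | y < e%:E]) [|N _ /(_ N (leqnn N)) /= GN].
  exact: open_ereal_lt'.
exists (\big[setU/set0]_(i < N) F i), (\bigcup_k U k); split => //.
- by apply: closed_bigsetU => i _; case: (FUP i).
- by apply: bigcup_open => i _; case: (FUP i).
- by rewrite -bigcup_mkord => x [k _ Fkx]; exists k => //; case: (FUP k) => _ _ + _ _; exact.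
- by apply: subset_bigcup => k _; case: (FUP k).
Qed.

Lemma outer_regular (A : set (borelT T)) (e : R) : measurable A -> (0 < e)%R ->
  exists2 U : set T, open U /\ A `<=` U & mu U <= mu A + e%:E.
Proof.
move=> mA e0.
have rA : regular A.
  apply: (smallest_sub _ _ mA) => [|U oU]; first split.
  - move=> d d0; exists set0, set0; split=> //; [exact: closed0|exact: open0|].
    by rewrite setD0 measure0 lte_fin.
  - by move=> B rB; rewrite setTD; exact: regularC.
  - exact: regular_bigcup.
  (* Open sets are reached as complements of closed ones, for which the inner approximation is the
     set itself. *)
  - rewrite -[U]setCK; apply: regularC => d d0.
    have cU : closed (~` U) by rewrite closedC.
    by have [V [oV UV] Vd] := closed_regular mu _ _ cU d0; exists (~` U), V; split.
have [F [U [cF oU FA AU /ltW mUF]]] := rA _ e0.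
exists U => //; have mU := open_borel _ oU; have mF := closed_borel _ cF.
rewrite -[X in mu X](setDUK AU) (le_trans (measureU2 _ _ _))//.
- exact: measurableD.
- rewrite leeD2l// (le_trans _ mUF)// le_measure ?inE//.
  + exact: measurableD.
  + exact: measurableD.
  + exact: setDS.
Qed.

End regularity.

(** The hypothesis speaks of continuous functions only. If [K x U] exceeds [a], so does [K x (V n)]
    for some [V n] in an increasing exhaustion of [U]; a continuous function between the indicators
    of [V n] and [U] transfers the bound to a neighbourhood of [x]. *)
Lemma lsc_kernel_open {R : realType} {T : pseudoPMetricType R}
    (K : borelT T -> {measure set borelT T -> \bar R}) (U : set T) :
  lsc_kernel K -> open U -> lower_semicontinuous (fun x : T => K x U).
Proof.
move=> lK oU x a aU.
have cU : closed (~` U) by rewrite closedC.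
pose V n := [set y : T | n.+1%:R^-1 < trunc_dist (~` U) y].
have oV n : open (V n).
  apply: (open_comp (D := [set r : R | n.+1%:R^-1 < r])); last exact: open_gt.
  by move=> y _; exact: trunc_dist_continuous.
have VU n : V n `<=` U.
  move=> y; apply: contraPP => Uy; rewrite /V /= trunc_dist0//.
  by rewrite ltNge invr_ge0 ler0n.
have bigcupV : \bigcup_n V n = U.
  apply/seteqP; split => [y [n _]|y Uy]; first exact: VU.
  have d0 : 0 < trunc_dist (~` U) y by apply: trunc_dist_gt0.
  have [n _ /(_ n (leqnn n))/= nd] := near_infty_natSinv_lt (PosNum d0).
  by exists n.
have : ((K x : set (borelT T) -> \bar R) \o V) n @[n --> \oo] --> K x (\bigcup_n V n).
  apply: nondecreasing_cvg_mu.
  - by move=> n; exact: open_borel.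
  - by rewrite bigcupV; exact: open_borel.
  - move=> n m nm; apply/subsetPset => y; apply: le_lt_trans.
    by rewrite lef_pV2 ?posrE// ler_nat.
rewrite bigcupV => /(_ [set y | (a%:E < y)%E]) [|n _ /(_ n (leqnn n)) /= aV].
  exact: open_ereal_gt'.
(* Equal to 1 on [V n], where the truncated distance exceeds 1/(n+1), and to 0 outside [U]. *)
pose f y := Num.min 1 (n.+1%:R * trunc_dist (~` U) y).
have f0 y : 0 <= f y by rewrite le_min ler01 mulr_ge0// trunc_dist_ge0.
have f1 y : f y <= 1 by rewrite ge_min lexx.
have cf : continuous f.
  move=> y; apply: (@continuous_min R T (cst 1) (fun z => n.+1%:R * trunc_dist (~` U) z)).
    exact: cst_continuous.
  by apply: cvgM; [exact: cvg_cst|exact: trunc_dist_continuous].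
have mf : measurable_fun [set: borelT T] (EFin \o f).
  by apply/measurable_EFinP; exact: continuous_borel.
have VfE z : (K z (V n) <= \int[K z]_y (f y)%:E)%E.
  have mV := open_borel _ (oV n).
  rewrite -[V n]setIT -integral_indic//; apply: ge0_le_integral => //.
  - by apply/measurable_EFinP.
  - move=> y _; rewrite lee_fin indicE; have [Vy|//] := boolP (y \in V n).
    have dy : n.+1%:R^-1 < trunc_dist (~` U) y by rewrite inE in Vy.
    rewrite le_min lexx/=.
    by rewrite -ler_pdivrMl// mulr1 ltW.
have fUE z : (\int[K z]_y (f y)%:E <= K z U)%E.
  have mU := open_borel _ oU.
  rewrite -[U]setIT -integral_indic//; apply: ge0_le_integral => //.
  - by move=> y _; rewrite lee_fin.
  - by apply/measurable_EFinP.
  - move=> y _; rewrite lee_fin indicE; have [//|/negP Uy] := boolP (y \in U).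
    have {}Uy : ~ U y by move=> ?; apply: Uy; rewrite inE.
    by rewrite /f trunc_dist0// mulr0 minElt ltNge ler01.
have [|W xW Wa] := lK f cf _ f0 x a (lt_le_trans aV (VfE x)).
  by exists 1 => y; rewrite ger0_norm.
by exists W => // y /Wa aKf; exact: lt_le_trans aKf (fUE y).
Qed.

(** * Composition of a measure with a submarkovian kernel, through the Giry monad *)

Section submarkov_giry.
Context {R : realType} {d} {X : measurableType d}.
Context (K : X -> {measure set X -> \bar R}) (K1 : forall x, (K x setT <= 1)%E).

(** A fresh name to which the subprobability structure given by [K1] can be attached, so that [K]
    becomes a map into [giry]. *)
Definition submarkov_measure (x : X) : set X -> \bar R := K x.

HB.instance Definition _ x := Measure.on (submarkov_measure x).
HB.instance Definition _ x :=
  Measure_isSubProbability.Build _ _ _ (submarkov_measure x) (K1 x).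

Definition submarkov_giry (x : X) : giry X R := submarkov_measure x.

End submarkov_giry.

(** The iterated integral is the integral against the monadic bind of [mu] and [K]. On measurable
    sets this bind agrees with [c] times [mu], hence so do the integrals of nonnegative
    functions. *)
Lemma integral_quasi_invariant {R : realType} {d} {X : measurableType d}
    (mu : probability X R) (K : X -> {measure set X -> \bar R}) (c : R)
    (h : X -> \bar R) :
  (forall A, measurable A -> measurable_fun [set: X] (K ^~ A)) ->
  (forall x, K x setT <= 1)%E ->
  0 <= c ->
  (forall A, measurable A -> \int[mu]_x K x A = c%:E * mu A)%E ->
  measurable_fun [set: X] h -> (forall x, 0 <= h x)%E ->
  (\int[mu]_x \int[K x]_y h y = c%:E * \int[mu]_y h y)%E.
Proof.
move=> mK K1 c0 muK mh h0.
pose k := submarkov_giry K K1.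
have mk : measurable_fun [set: X] k by exact: measurable_giry_codensity.
have := giry_int_bind (mu : subprobability X R) mk mh h0.
rewrite /giry_int /= => <-.
rewrite (eq_measure_integral (mscale (NngNum c0) mu)) ?ge0_integral_mscale//.
move=> A mA _.
have m1 : measurable_fun [set: X] (EFin \o \1_A : X -> \bar R).
  by apply/measurable_EFinP.
have := giry_int_bind (mu : subprobability X R) mk m1 (fun x => ltac:(by rewrite lee_fin)).
rewrite /giry_int /= integral_indic// setIT => bindE.
apply: (etrans bindE); rewrite /mscale /= -muK//.
by apply: eq_integral => x _; rewrite integral_indic// setIT.
Qed.

(** * Multiplicative functions of time with values in (0, 1] are exponentials *)

Section multiplicative.
Context {R : realType} (disc : bool) (l : R -> R).
Hypothesis l_gt0 : forall t, is_time disc t -> 0 < l t.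
Hypothesis l_le1 : forall t, is_time disc t -> l t <= 1.
Hypothesis lD : forall s t, is_time disc s -> is_time disc t ->
  l (s + t) = l s * l t.

Lemma is_time_nat n : is_time disc (n%:R : R).
Proof. by split => // _; exact: natr_nat. Qed.

Lemma is_timeM n (t : R) : is_time disc t -> is_time disc (n%:R * t).
Proof.
move=> [t0 tN]; split => [|dd]; first by rewrite mulr_ge0.
by rewrite rpredM ?natr_nat// tN.
Qed.

Lemma is_timeB_trunc (t : R) : is_time disc t ->
  is_time disc (t - (Num.trunc t)%:R).
Proof.
move=> [t0 tN]; split => [|dd]; first by rewrite subr_ge0 truncn_le.
have /natrP[n ->] := tN dd.
by rewrite natrK subrr; exact: (natr_nat _ 0).
Qed.

Let l0 : l 0 = 1.
Proof.
have t0 := is_time_nat 0.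
apply: (mulfI (lt0r_neq0 (l_gt0 _ t0))).
by rewrite -lD// addr0 mulr1.
Qed.

Let lM n t : is_time disc t -> l (n%:R * t) = l t ^+ n.
Proof.
move=> tt; elim: n => [|n IHn]; first by rewrite mul0r expr0.
rewrite -natr1 mulrDl mul1r lD//; last exact: is_timeM.
by rewrite IHn exprSr.
Qed.

(* Comparing l (n t) with the values of l at the integers next to n t gives
   |ln (l t) - t ln (l 1)| <= - ln (l 1) / n for every n. *)
Lemma multiplicative_powR t : is_time disc t -> l t = l 1 `^ t.
Proof.
move=> tt; have t1 := is_time_nat 1.
have lt0 := l_gt0 _ tt; have l10 := l_gt0 _ t1.
suff lnE : ln (l t) = t * ln (l 1).
  by rewrite /powR gt_eqF// -lnE lnK.
apply/eqP; rewrite -subr_eq0 -normr_eq0; apply/eqP.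
set D := `|_|; set L := ln (l 1).
have L0 : L <= 0 by rewrite ln_le0// l_le1.
have nD n : n%:R * D <= - L.
  have ntt := is_timeM n _ tt.
  set m := Num.trunc (n%:R * t).
  have /andP[mt tm] : m%:R <= n%:R * t < m.+1%:R by apply: truncn_itv; case: ntt.
  have lnlE : ln (l (n%:R * t)) = n%:R * ln (l t).
    by rewrite lM// lnXn// mulr_natl.
  have lnm k : ln (l k%:R) = k%:R * L.
    by rewrite -[k%:R]mulr1 lM// lnXn// mulr1 mulr_natl.
  have mT := is_time_nat m; have m1T := is_time_nat m.+1.
  have tmT := is_timeB_trunc _ ntt.
  have mtT : is_time disc (m.+1%:R - n%:R * t).
    split => [|dd]; first by rewrite subr_ge0 ltW.
    have /natrP[k kE] := ntt.2 dd.
    move: tm; rewrite kE ltr_nat => km.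
    by rewrite -natrB ?natr_nat// ltnW.
  (* Since [l] is multiplicative and at most 1, it is nonincreasing: the time gap contributes a
     factor at most 1. The next bound uses the gap up to [m.+1] likewise. *)
  have up : n%:R * ln (l t) <= m%:R * L.
    rewrite -lnlE -lnm ler_ln ?posrE; [|exact: l_gt0|exact: l_gt0].
    rewrite -[n%:R * t](subrK m%:R) lD// ger_pMl; last exact: l_gt0.
    exact: l_le1.
  have low : m.+1%:R * L <= n%:R * ln (l t).
    rewrite -lnlE -lnm ler_ln ?posrE; [|exact: l_gt0|exact: l_gt0].
    rewrite -[m.+1%:R](subrK (n%:R * t)) lD// ger_pMl; last exact: l_gt0.
    exact: l_le1.
  rewrite /D -[n%:R]ger0_norm// -normrM ler_norml opprK.
  have tL : m.+1%:R * L <= n%:R * t * L <= m%:R * L.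
    by rewrite !ler_wnM2r// ltW.
  move: tL up low; rewrite -[m.+1%:R]natr1 mulrDl mul1r mulrBr mulrA -/L.
  by move=> /andP[? ?] ? ?; apply/andP; split; lra.
apply/eqP; rewrite eq_le normr_ge0 andbT leNgt; apply/negP => D0.
(* If [D] were positive, this integer would exceed [- L / D], against [nD]. *)
have := nD (Num.trunc (- L / D)).+1.
rewrite leNgt -ltr_pdivrMr// => /negP; apply.
have NL0 : 0 <= - L by rewrite oppr_ge0.
by have /andP[] := truncn_itv (divr_ge0 NL0 (ltW D0)).
Qed.

End multiplicative.

(** * Exponential survival under a quasi-stationary distribution *)

Section quasi_stationary.
Context {R : realType} {T : pseudoPMetricType R} (disc : bool).
Context (P : R -> borelT T -> {measure set borelT T -> \bar R}).
Context (pi : probability (borelT T) R).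
Hypothesis sP : submarkov_semigroup disc P.
Hypothesis qsd : is_QSD disc P pi.

Definition survival (t : R) : R := fine (muP P pi t setT).

Let mP {t} {A : set (borelT T)} : is_time disc t -> measurable A ->
  measurable_fun [set: borelT T] (P t ^~ A).
Proof. by move=> tt mA; case: sP => /(_ _ tt)[+ _] _; exact. Qed.

Let P1 {t} (A : set (borelT T)) x : is_time disc t -> measurable A ->
  (P t x A <= 1)%E.
Proof.
move=> tt mA; case: sP => /(_ _ tt)[_ P1] _; apply: le_trans (P1 x).
by rewrite le_measure ?inE.
Qed.

Let muP_le1 {t} (A : set (borelT T)) : is_time disc t -> measurable A ->
  (muP P pi t A <= 1)%E.
Proof.
move=> tt mA; rewrite /muP.
apply: (@le_trans _ _ (\int[pi]_x cst 1 x)%E).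
  by apply: ge0_le_integral => //; [exact: mP|move=> x _; exact: P1].
by rewrite integral_cst// mul1e; exact: probability_le1.
Qed.

Let muP_fin {t} (A : set (borelT T)) : is_time disc t -> measurable A ->
  muP P pi t A \is a fin_num.
Proof.
move=> tt mA; rewrite ge0_fin_numE; last exact: integral_ge0.
exact: le_lt_trans (muP_le1 _ tt mA) (ltry _).
Qed.

Lemma survival_gt0 t : is_time disc t -> 0 < survival t.
Proof.
move=> tt; rewrite -lte_fin fineK; first by case: (qsd _ tt).
exact: muP_fin.
Qed.

Lemma survival_le1 t : is_time disc t -> survival t <= 1.
Proof.
move=> tt; rewrite -lee_fin fineK; first exact: muP_le1.
exact: muP_fin.
Qed.

Lemma muP_survival t A : is_time disc t -> measurable A ->
  (muP P pi t A = (survival t)%:E * pi A)%E.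
Proof.
move=> tt mA; have [_ /(_ _ mA) E] := qsd _ tt.
have pif : pi A \is a fin_num by exact: fin_num_measure.
rewrite -[pi A]fineK// -EFinM -E mulrC divfK; last first.
  by rewrite gt_eqF// survival_gt0.
by rewrite fineK// muP_fin.
Qed.

(** By Chapman-Kolmogorov, survival to [s + t] integrates the survival probability over [t] against
    pi P_s, which is [survival s] times pi. *)
Lemma survivalD s t : is_time disc s -> is_time disc t ->
  survival (s + t) = survival s * survival t.
Proof.
move=> ts tt.
have stT : is_time disc (s + t).
  case: ts tt => s0 sN [t0 tN].
  by split => [|dd]; [exact: addr_ge0|rewrite rpredD ?sN ?tN].
have fineE u : is_time disc u -> (survival u)%:E = muP P pi u setT.
  by move=> uT; rewrite fineK//; exact: muP_fin.
apply: EFin_inj; rewrite EFinM !(fineE _ stT, fineE _ tt).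
rewrite [LHS](_ : _ = \int[pi]_x \int[P s x]_y P t y setT)%E; last first.
  by apply: eq_integral => x _; case: sP => _ [_ ->].
rewrite (integral_quasi_invariant pi (P s) (survival s))//.
- by move=> A mA; exact: mP.
- by move=> x; exact: P1.
- exact/ltW/survival_gt0.
- by move=> A mA; exact: muP_survival.
- exact: mP.
Qed.

Lemma survival_powR t : is_time disc t -> survival t = lam P pi `^ t.
Proof.
move=> tt.
exact: (multiplicative_powR _ _ survival_gt0 survival_le1 survivalD _ tt).
Qed.

(** * Time reversal and the pointwise bound on the kernel *)

Section reverse.
Context (t2 C2' : R) (R2 : borelT T -> {measure set borelT T -> \bar R}).
Hypothesis rad : RaD disc P pi t2 R2 C2'.

Let t2T : is_time disc t2. Proof. by case: rad => -[_ t2T _] _. Qed.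

Let mR2 (A : set (borelT T)) : measurable A ->
  measurable_fun [set: borelT T] (R2 ^~ A).
Proof. by case: rad => -[_ _ [+ _]] _; exact. Qed.

(** This is the reversal identity evaluated on the rectangle [B] times [A]. *)
Lemma reverse_balance (A B : set (borelT T)) : measurable A -> measurable B ->
  (\int[pi]_(x in B) P t2 x A = \int[pi]_(y in A) R2 y B)%E.
Proof.
move=> mA mB; case: rad => _ [/(_ (B `*` A) (measurableX mB mA)) E _].
rewrite [LHS]integral_mkcond [RHS]integral_mkcond.
transitivity (\int[pi]_x P t2 x (xsection (B `*` A) x))%E.
  apply: eq_integral => x _; rewrite patchE.
  case: ifPn => xB; first by rewrite in_xsectionX.
  by rewrite notin_xsectionX// measure0.
rewrite E; apply: eq_integral => y _; rewrite patchE.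
case: ifPn => yA; first by rewrite in_ysectionX.
by rewrite notin_ysectionX// measure0.
Qed.

(** By balance, the integral of R2 1 over any Borel [E] is (pi P_t2)(E), that is
    [survival t2 * pi E]; equal integrals over all [E] force equality almost everywhere. *)
Lemma reverse_mass : {ae pi, forall y, R2 y setT = (survival t2)%:E}.
Proof.
have R2E : forall E : set (borelT T), measurable E ->
    (\int[pi]_(y in E) R2 y setT = \int[pi]_(y in E) cst (survival t2)%:E y)%E.
  by move=> E mE; rewrite -reverse_balance// integral_cst// -muP_survival.
have : ae_eq pi setT (R2 ^~ setT) (cst (survival t2)%:E).
  apply: integral_ae_eq => //; last by move=> E _; exact: R2E.
  apply/integrableP; split; first exact: mR2.
  under eq_integral do rewrite gee0_abs//.
  by rewrite R2E// integral_cst// ltey_eq fin_numM// fin_num_measure.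
by apply: filterS => y; exact.
Qed.

Lemma reverse_ae_le : {ae pi, forall y, forall A, measurable A ->
  R2 y A <= (survival t2 * C2')%:E * pi A}%E.
Proof.
case: rad => _ [_ [rae _]].
apply: filterS2 reverse_mass rae => y -> + A mA => /(_ A mA).
by rewrite -EFinM [in X in _ -> X]mulrC.
Qed.

(** The sign of [C2'] is not assumed. It is read off the almost sure bound on the whole space at a
    single point, which exists because pi has positive mass. *)
Lemma reverse_const_ge0 : 0 <= survival t2 * C2'.
Proof.
have pT0 : (0 < pi setT)%E by rewrite probability_setT.
have [y R2y] := @filter_ex _ _ (ae_properfilter_algebraOfSetsType pT0) _ reverse_ae_le.
have := le_trans (measure_ge0 (R2 y) setT) (R2y setT measurableT).
by rewrite probability_setT mule1 lee_fin.
Qed.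

Lemma integral_kernel_le (A B : set (borelT T)) : measurable A -> measurable B ->
  (\int[pi]_(x in B) P t2 x A <= (survival t2 * C2')%:E * pi A * pi B)%E.
Proof.
move=> mA mB; rewrite reverse_balance//.
have c0 : (0 <= (survival t2 * C2')%:E * pi B)%E.
  by rewrite mule_ge0// lee_fin reverse_const_ge0.
rewrite -muleA [(pi A * _)%E]muleC muleA -integral_cst//.
apply: ae_ge0_le_integral => //.
- by apply: measurable_funTS; exact: mR2.
- by apply: filterS reverse_ae_le => y R2y _; exact: R2y.
Qed.

Lemma kernel_open_le (x : T) (U : set T) : open U ->
  (P t2 x U <= (survival t2 * C2')%:E * pi U)%E.
Proof.
move=> oU; case: rad => _ [_ [_ [sptT lP]]].
have mU := open_borel _ oU.
have piUf : pi U \is a fin_num by exact: fin_num_measure.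
rewrite leNgt; apply/negP => cP.
have Pf : P t2 x U \is a fin_num.
  by rewrite ge0_fin_numE// (le_lt_trans (P1 _ _ t2T mU))// ltry.
set c := (X in (X < _)%E) in cP.
have cf : c \is a fin_num by rewrite fin_numM.
(* A midpoint keeps [a] strictly above [c], so the averaged inequality over [B] is contradictory
   once [pi B] is cancelled. *)
pose a := (fine c + fine (P t2 x U)) / 2.
have cPf : fine c < fine (P t2 x U) by rewrite fine_lt.
have ca : (c < a%:E)%E by rewrite -(fineK cf) lte_fin /a midf_lt.
have aP : (a%:E < P t2 x U)%E by rewrite -(fineK Pf) lte_fin /a midf_lt.
pose B := [set y : T | (a%:E < P t2 y U)%E].
have oB : open B.
  by have /lower_semicontinuousP := lsc_kernel_open _ _ lP oU; exact.
have mB := open_borel _ oB.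
have piB : (0 < pi B)%E.
  have : spt pi x by rewrite sptT.
  by move=> /(_ B oB); apply.
have piBf : pi B \is a fin_num by exact: fin_num_measure.
have : (a%:E * pi B <= c * pi B)%E.
  apply: le_trans (integral_kernel_le _ _ mU mB).
  rewrite -integral_cst//; apply: ge0_le_integral => //.
  - move=> y _; apply: le_trans (ltW ca).
    by rewrite mule_ge0// lee_fin reverse_const_ge0.
  - by apply: measurable_funTS; exact: mP.
  - by move=> y /ltW.
by rewrite lee_pmul2r// => /(lt_le_trans ca); rewrite ltxx.
Qed.

Lemma kernel_le (x : borelT T) (A : set (borelT T)) : measurable A ->
  (P t2 x A <= (survival t2 * C2')%:E * pi A)%E.
Proof.
move=> mA; have c0 := reverse_const_ge0.
apply/lee_addgt0Pr => e e0.
(* Adding 1 keeps the denominator positive when the constant is 0, and the constant times this error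
   is still at most [e]. *)
have d0 : 0 < e / (survival t2 * C2' + 1) by rewrite divr_gt0// ltr_wpDl.
have [U [oU AU] piU] := outer_regular pi A _ mA d0.
have mU := open_borel _ oU.
apply: (@le_trans _ _ (P t2 x U)); first by rewrite le_measure ?inE.
apply: (le_trans (kernel_open_le _ _ oU)).
apply: (@le_trans _ _ ((survival t2 * C2')%:E * (pi A + (e / (survival t2 * C2' + 1))%:E))%E).
  by rewrite lee_wpmul2l.
rewrite ge0_muleDr//; last by rewrite lee_fin ltW.
rewrite leeD2l// -EFinM lee_fin mulrCA ger_pMr// ler_pdivrMr ?ltr_wpDl//.
by rewrite mul1r lerDl.
Qed.

End reverse.
End quasi_stationary.

Theorem mainTheorem3 (R : realType) (T : pseudoPMetricType R)
    (disc : bool) (P : R -> borelT T -> {measure set borelT T -> \bar R})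
    (pi : probability (borelT T) R)
    (t2 C2' : R) (R2 : borelT T -> {measure set borelT T -> \bar R}) :
  hausdorff_space T ->
  submarkov_semigroup disc P ->
  is_QSD disc P pi ->
  RaD disc P pi t2 R2 C2' ->
  forall (x : borelT T) (A : set (borelT T)), measurable A ->
    (P t2 x A <= ((lam P pi) `^ t2 * C2')%:E * pi A)%E.
Proof.
move=> _ sP qsd rad x A mA.
rewrite -(survival_powR disc P pi sP qsd); last by case: rad => -[_ t2T _] _.
exact: (kernel_le disc P pi sP qsd t2 C2' R2 rad).
Qed.
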